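(* Let $\rho>0$, $k\ge1$, and let $X$ be a self-adjoint operator in a tracial $W^*$-probability space $(\mathcal{M},\tau)$ which admits higher-order free Stein kernels $A_1,\dots,A_k$ up to order $k$ with respect to the potential $V_\rho$. Then $\tau(P(X))=\tau(P(S_\rho))$ for every polynomial $P\in\mathbb{C}[t]$ of degree at most $k$. Moreover, if $\tau(P(X))=\tau(P(S_\rho))$ also holds for polynomials of degree $k+1$, then these kernels are centered: $\tau^{\otimes(k+1)}(A_k)=0$.
   Context: $V_\rho(t)=\frac{\rho}{2}t^2$, so its cyclic derivative is $\mathcal{D}V_\rho(t)=\rho t$. $S_\rho$ is a semicircular variable of mean $0$ and variance $\rho^{-1}$ (density $\frac{\rho}{2\pi}\sqrt{4/\rho-x^2}$ on $|x|\le 2/\sqrt\rho$). The free difference quotient $\partial:\mathbb{C}[t]\to\mathbb{C}[t]\otimes\mathbb{C}[t]$ is the linear map with $\partial t^m=\sum_{j=1}^m t^{j-1}\otimes t^{m-j}$, and $\partial^k=(\partial\otimes id^{\otimes(k-1)})\circ\cdots\circ(\partial\otimes id)\circ\partial:\mathbb{C}[t]\to\mathbb{C}[t]^{\otimes(k+1)}$. $[\partial^kP](X)$ denotes evaluation at $X$ in each tensor factor. Inner products: $\langle a,b\rangle_\tau=\tau(b^*a)$ and $\langle A,B\rangle_2=\tau^{\otimes(k+1)}(AB^* )$ on $L^2(\mathcal{M}^{\otimes(k+1)})$. A free Stein kernel of order $k$ for $X$ with respect to $V_\rho$ is an element $A_k\in L^2(\mathcal{M}^{\otimes(k+1)})$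 such that for every $P\in\mathbb{C}[t]$ $$\langle[\mathcal{D}V_\rho](X),P(X)\rangle_\tau-(\tau\otimes\tau)\big(([\partial P](X))^*\big)=\langle A_k,[\partial^kP](X)\rangle_2 .$$ *)

(* Defs.v *)
From mathcomp Require Import all_boot all_order all_algebra.
From mathcomp Require Import sesquilinear complex freeg.
From mathcomp Require Import all_classical all_reals all_analysis.

Set Implicit Arguments.
Unset Strict Implicit.
Unset Printing Implicit Defensive.

Import Order.TTheory GRing.Theory Num.Theory.
Import numFieldNormedType.Exports.

Local Open Scope classical_set_scope.
Local Open Scope ring_scope.
Local Open Scope complex_scope.

(* The norm is a field of the record: the library has no join of [algType] and
   [completeNormedModType]. *)
Record cstarAlgebra (R : realType) := CstarAlgebra {
  cstar_sort :> algType R[i];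
  star : cstar_sort -> cstar_sort;
  cnorm : cstar_sort -> R;
  star_antilinear : forall (c : R[i]) x y,
    star (c *: x + y) = c^* *: star x + star y;
  starM : forall x y, star (x * y) = star y * star x;
  starK : involutive star;
  cnorm_eq0 : forall x, cnorm x = 0 -> x = 0;
  cnormZ : forall (c : R[i]) x, (cnorm (c *: x))%:C = `|c| * (cnorm x)%:C;
  cnormD : forall x y, cnorm (x + y) <= cnorm x + cnorm y;
  cnormM : forall x y, cnorm (x * y) <= cnorm x * cnorm y;
  cnorm_star : forall x, cnorm (star x * x) = cnorm x ^+ 2;
  cnorm_complete : forall u : nat -> cstar_sort,
    (forall e : R, 0 < e -> exists N, forall p q,
       (N <= p)%N -> (N <= q)%N -> cnorm (u p - u q) < e) ->
    exists l, forall e : R, 0 < e -> exists N, forall p,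
      (N <= p)%N -> cnorm (u p - l) < e }.

(* Sakai's definition: the pairing identifies the algebra isometrically with
   the Banach dual of its predual. *)
Record wstarAlgebra (R : realType) := WstarAlgebra {
  wstar_cstar :> cstarAlgebra R;
  predual : completeNormedModType R[i];
  pairing : {bilinear wstar_cstar -> predual -> R[i] | *%R & *%R};
  pairing_le : forall x e, `|pairing x e| <= (cnorm x)%:C * `|e|;
  pairing_norm : forall x (c : R), 0 <= c ->
    (forall e, `|pairing x e| <= c%:C * `|e|) -> cnorm x <= c;
  pairing_onto : forall f : {scalar predual},
    (exists c : R, forall e, `|f e| <= c%:C * `|e|) ->
    exists x, forall e, pairing x e = f e }.
Arguments pairing {R} w.

Record tracialWstar (R : realType) := TracialWstar {
  tracial_wstar :> wstarAlgebra R;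
  tr : {scalar tracial_wstar};
  tr1 : tr 1 = 1;
  trC : forall x y, tr (x * y) = tr (y * x);
  tr_ge0 : forall x, 0 <= tr (star x * x);
  tr_faithful : forall x, tr (star x * x) = 0 -> x = 0;
  (* normality: the trace is weak-* continuous, i.e. it lies in the predual *)
  tr_normal : exists e : predual tracial_wstar, forall x,
    tr x = pairing tracial_wstar x e }.

Definition selfadjoint (R : realType) (M : tracialWstar R) (x : M) : Prop :=
  star x = x.

Definition tau_dot (R : realType) (M : tracialWstar R) (a b : M) : R[i] :=
  tr M (star b * a).

(* L^2 of the n-fold tensor power of (M, tau), which is determined up to unitary
   isomorphism: the Hilbert completion of the algebraic tensor power for
   <A, B> = tau^{(x) n} (A B^* ).  [elem a] is the elementary tensor
   a_0 (x) ... (x) a_(n-1), and [L2star] is the continuous extension of the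
   involution. *)
Record L2tensor (R : realType) (M : tracialWstar R) (n : nat) := L2Tensor {
  L2sort :> completeNormedModType R[i];
  L2dot : {dot L2sort for Num.conj};
  L2dot_norm : forall v, L2dot v v = `|v| ^+ 2;
  elem : ('I_n -> M) -> L2sort;
  elem_linear : forall (a : 'I_n -> M) (i : 'I_n),
    linear (fun x : M => elem [eta a with i |-> x]);
  elem_dot : forall a b : 'I_n -> M,
    L2dot (elem a) (elem b) = \prod_(i < n) tr M (a i * star (b i));
  elem_dense : dense [set v | exists m (c : 'I_m -> R[i])
    (a : 'I_m -> 'I_n -> M), v = \sum_(j < m) c j *: elem (a j)];
  L2star : L2sort -> L2sort;
  L2star_antilinear : forall (c : R[i]) u v,
    L2star (c *: u + v) = c^* *: L2star u + L2star v;
  L2star_isometry : forall v, `|L2star v| = `|v|;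
  L2star_elem : forall a : 'I_n -> M,
    L2star (elem a) = elem (fun i => star (a i)) }.

(* The continuous extension to L^2 of tau^{(x) n}, as tau^{(x) n} (A) = <A, 1>. *)
Definition L2tr (R : realType) (M : tracialWstar R) (n : nat)
    (H : L2tensor M n) (A : H) : R[i] :=
  L2dot H A (elem H (fun=> 1)).

(* C[t]^{(x) n} as the free C-module on exponents: the basis element <<m>>
   stands for t^(m_0) (x) ... (x) t^(m_(n-1)). *)
Definition polyT (R : realType) (n : nat) := {freeg (n.-tuple nat) / R[i]}.

Definition poly_polyT (R : realType) (P : {poly R[i]}) : polyT R 1 :=
  \sum_(m < size P) P`_m *: << [tuple (m : nat)] >>.

(* d (x) id^{(x) n}, acting on the first tensor factor *)
Definition fdq_first (R : realType) (n : nat) :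
    polyT R n.+1 -> polyT R n.+2 :=
  fglift (fun m : n.+1.-tuple nat =>
    \sum_(1 <= j < (thead m).+1)
      << [tuple of j.-1 :: (thead m - j)%N :: behead_tuple m] >> : polyT R n.+2).

(* The k-th iterated free difference quotient; for k = 0 it is the
   identification of C[t] with its first tensor power. *)
Fixpoint fdq (R : realType) (k : nat) (P : {poly R[i]}) : polyT R k.+1 :=
  if k is k'.+1 then fdq_first (fdq k' P) else poly_polyT P.

(* multiplication after the flip after the free difference quotient *)
Definition cyclic_derivative (R : realType) (P : {poly R[i]}) : {poly R[i]} :=
  fglift (fun m : 2.-tuple nat =>
    'X^(tnth m ord_max) * 'X^(tnth m ord0) : {poly R[i]}) (fdq 1 P).

Definition evalT (R : realType) (M : tracialWstar R) (n : nat)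
    (H : L2tensor M n) (X : M) (T : polyT R n) : H :=
  fglift (fun m : n.-tuple nat => elem H (fun i => X ^+ tnth m i)) T.

Definition potential (R : realType) (rho : R) : {poly R[i]} :=
  (rho / 2)%:C *: 'X^2.

Definition free_stein_kernel (R : realType) (M : tracialWstar R)
    (H : forall n, L2tensor M n) (rho : R) (X : M) (k : nat)
    (A : H k.+1) : Prop :=
  forall P : {poly R[i]},
    tau_dot (horner_alg X (cyclic_derivative (potential rho))) (horner_alg X P)
      - L2tr (L2star (evalT (H 2) X (fdq 1 P)))
    = L2dot (H k.+1) A (evalT (H k.+1) X (fdq k P)).

Definition semicircle_density (R : realType) (rho x : R) : R :=
  rho / (2 * pi) * Num.sqrt (4 / rho - x ^+ 2).

Definition semicircular (R : realType) (M : tracialWstar R) (rho : R) (S : M) :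
    Prop :=
  selfadjoint S /\
  forall n : nat, tr M (S ^+ n) =
    (\int[lebesgue_measure]_(x in `[- (2 / Num.sqrt rho), 2 / Num.sqrt rho])
       (x ^+ n * semicircle_density rho x))%:C.

(* Main.v *)
From HB Require Import structures.
Require Import Defs.
From mathcomp Require Import all_boot all_order all_algebra.
From mathcomp Require Import sesquilinear complex freeg.
From mathcomp Require Import all_classical all_reals all_analysis.
From mathcomp Require Import ring lra.

Import Order.TTheory GRing.Theory Num.Theory.
Import numFieldNormedType.Exports.

Local Open Scope ring_scope.

(** Tested on the monomial t^m, the left-hand side of the Stein equation is
    rho tau(X^(m+1)) - sum_(i < m) tau(X^i) tau(X^(m-1-i)), the defect in the
    Schwinger-Dyson equation of degree m for the moments of X.

    A kernel of order k sees only the k-th free difference quotient of t^m.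
    It vanishes for m < k, so the Schwinger-Dyson equations of degree less than
    k hold for X ([stein_kernel_schwinger_dyson]).  Each of these equations
    computes a moment from lower ones, hence together they determine the
    moments up to order k.  For m = k the quotient is 1 (x) ... (x) 1, so the
    mean of the kernel is exactly the Schwinger-Dyson defect of degree k
    ([stein_kernel_mean]).  A kernel of order i is therefore centered as soon as
    the moments of X up to order i + 1 satisfy the equation of degree i, and
    agreement with the semicircular moments up to order k + 1 gives this for
    every i <= k.

    What is left is that the semicircular moments c n satisfy every
    Schwinger-Dyson equation ([semicircular_schwinger_dyson]).  Integrating the
    derivative of x^n (r^2 - x^2)^(3/2) over [-r, r], with r^2 = 4 / rho, gives
    the linear recursion rho (n + 4) c (n+2) = 4 (n + 1) c n.  This is the
    two-term recursion of the Catalan numbers, and it implies the quadratic one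
    by a symmetrization argument ([schwinger_dyson_catalan]).  The normalization
    c 0 = 1 is that of the trace. *)

(** * The Schwinger-Dyson recursion *)

(** The index m - i.+1 makes the two exponents add up to m - 1, so that
    [autoconv c 0] is an empty sum.  This is (tau (x) tau)(d t^m) when [c] is
    the sequence of moments. *)
Definition autoconv {F : pzSemiRingType} (c : nat -> F) (m : nat) : F :=
  \sum_(i < m) c i * c (m - i.+1)%N.

Definition schwinger_dyson {F : pzSemiRingType} (r : F) (c : nat -> F) (m : nat) :=
  r * c m.+1 = autoconv c m.

Lemma autoconv_local {F : pzSemiRingType} (c d : nat -> F) (m : nat) :
  (forall i, (i < m)%N -> c i = d i) -> autoconv c m = autoconv d m.
Proof.
move=> cd; apply: eq_bigr => i _; rewrite !cd //.
by rewrite ltn_subrL; case: m i {cd} => [[]|].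
Qed.

Lemma schwinger_dyson_unique {F : idomainType} (r : F) (c d : nat -> F) (k : nat) :
    r != 0 -> c 0%N = d 0%N ->
    (forall m, (m < k)%N -> schwinger_dyson r c m) ->
    (forall m, (m < k)%N -> schwinger_dyson r d m) ->
  forall n, (n <= k)%N -> c n = d n.
Proof.
move=> r0 cd0 sc sd n; elim/ltn_ind: n => -[//|n] IH nk.
apply: (mulfI r0); rewrite sc // sd //.
apply: autoconv_local => i ni; apply: IH; first exact: leqW.
exact: leq_trans (ltnW ni) (ltnW nk).
Qed.

Lemma schwinger_dyson_local {F : pzSemiRingType} (r : F) (c d : nat -> F) (m : nat) :
    (forall i, (i <= m.+1)%N -> c i = d i) ->
  schwinger_dyson r d m -> schwinger_dyson r c m.
Proof.
move=> cd sd; rewrite /schwinger_dyson cd // sd.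
by apply: esym; apply: autoconv_local => i im; apply: cd; exact: ltnW (leqW im).
Qed.

(** Reversing the order of summation exchanges the weights i and n - i, so each
    of them counts for half of their sum n. *)
Lemma autoconv_weighted {F : comPzRingType} (c : nat -> F) (d n : nat) :
  2 * (\sum_(i < n.+1) (i + d)%:R * (c i * c (n - i)%N)) =
  (n + d.*2)%:R * autoconv c n.+1.
Proof.
rewrite mulr2n mulrDl mul1r {1}(reindex_inj rev_ord_inj) -big_split mulr_sumr.
apply: eq_bigr => i _ /=; rewrite subSS subKn ?leq_ord //.
rewrite [c (n - i)%N * _]mulrC -mulrDl -natrD addnACA subnK ?leq_ord //.
by rewrite addnn.
Qed.

(** The Catalan recursion C_(p+1) = sum C_i C_(p-i) follows from
    (p + 2) C_(p+1) = 2 (2p + 1) C_p, here for the interleaved sequence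
    C_0, 0, C_1, 0, ... rescaled by powers of [r].  Weighting the terms
    of the convolution square with i + 2 multiplies it by a known factor, by
    symmetry; applying the linear recursion inside the same weighted sum
    expresses it through the square two degrees lower, with weight i + 1, which
    symmetry evaluates as well. *)
Lemma schwinger_dyson_catalan {F : numFieldType} (r : F) (c : nat -> F) :
    r != 0 -> c 0%N = 1 -> c 1%N = 0 ->
    (forall n, r * n.+4%:R * c n.+2 = 4 * n.+1%:R * c n) ->
  forall m, schwinger_dyson r c m.
Proof.
move=> r0 c0 c1 crec [|n].
  by rewrite /schwinger_dyson /autoconv big_ord0 c1 mulr0.
move: n; rewrite /schwinger_dyson.
suff step n :
    r * c n.+2 = autoconv c n.+1 -> r * c n.+4 = autoconv c n.+3.
  suff H n : r * c n.+2 = autoconv c n.+1 /\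
             r * c n.+3 = autoconv c n.+2 by move=> n; have [] := H n.
  elim: n => [|n [IH0 IH1]]; last by split; [|exact: step].
  rewrite /autoconv !big_ord_recl !big_ord0 /= /bump /=.
  rewrite !(subSS, subn0, subnn, addn0) c1 c0.
  have /= := crec 0%N; have /= := crec 1%N; rewrite c0 c1 => e1 e0; split.
    apply: (@mulfI _ (4%:R : F)); first by rewrite pnatr_eq0.
    by ring: e0.
  apply: (@mulfI _ (5%:R : F)); first by rewrite pnatr_eq0.
  by ring: e1.
(* V is the sum of degree n with weights i + 1.  W is what remains of the sum of
   degree n + 2 with weights i + 2 once the terms of c 0 and c 1 are removed. *)
move=> IH; have := autoconv_weighted c 2 n.+2.
have := autoconv_weighted c 1 n; rewrite -IH.
set V := \sum_(i < n.+1) _; rewrite 2!big_ord_recl /= /bump /= subn0 c1 c0.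
set W := \sum_(i < n.+1) _.
have rW : r * W = 4 * V.
  rewrite !mulr_sumr; apply: eq_bigr => i _.
  by rewrite !add1n !subSS !addSn addn2 addn1 !mulrA crec -!mulrA.
rewrite !(doubleS, double0, addnS, addn0) => eV eW.
apply: (@mulfI _ (r * n.+2.+4%:R)); first by rewrite mulf_neq0 ?pnatr_eq0.
rewrite [LHS]mulrCA crec.
have -> : r * n.+2.+4%:R * autoconv c n.+3 = 4 * (r * c n.+2) + 2 * (r * W).
  by rewrite -mulrA -eW; ring.
have -> : 2 * (r * W) = 4 * (2 * V) by rewrite rW; ring.
by rewrite eV; ring.
Qed.

(** * Moments of the semicircle law *)

Section SemicircleMoments.
Local Open Scope classical_set_scope.
Local Open Scope ring_scope.
Local Open Scope complex_scope.

Lemma continuous_semicircle (R : realType) (a : R) :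
  continuous (fun x : R => Num.sqrt (a - x ^+ 2)).
Proof.
move=> x; apply: (@continuous_comp _ _ _ (fun x : R => a - x ^+ 2) Num.sqrt).
  by apply: cvgB; [exact: cvg_cst|exact: exprn_continuous].
exact: sqrt_continuous.
Qed.

(** The power (a - y^2)^(3/2), written as (a - y^2) sqrt (a - y^2), is the one
    that serves as a primitive: its derivative is a polynomial multiple of
    sqrt (a - y^2), with no singularity at the endpoints. *)
Lemma is_derive_semicircle (R : realType) (a x : R) (n : nat) : x ^+ 2 < a ->
  is_derive x 1 (fun y => y ^+ n * ((a - y ^+ 2) * Num.sqrt (a - y ^+ 2)))
   ((n%:R * x ^+ n.-1 * (a - x ^+ 2) - 3 * x ^+ n.+1) * Num.sqrt (a - x ^+ 2)).
Proof.
move=> xa; have s0 : 0 < Num.sqrt (a - x ^+ 2) by rewrite sqrtr_gt0 subr_gt0.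
have h : 0 < a - x ^+ 2 by rewrite subr_gt0.
have dq : is_derive x 1 (fun y : R => a - y ^+ 2) (- (2 * x)).
  by apply: is_derive_eq; rewrite !scaler1; ring.
have ds : is_derive x 1 (fun y : R => Num.sqrt (a - y ^+ 2))
     ((2 * Num.sqrt (a - x ^+ 2))^-1 * (- (2 * x))).
  apply: (@is_derive1_comp _ Num.sqrt (fun y : R => a - y ^+ 2)).
  exact: is_derive1_sqrt.
have dn : is_derive x 1 (fun y : R => y ^+ n) (n%:R * x ^+ n.-1).
  have := is_deriveX n (is_derive_id x (1:R)); rewrite fctE scaler1; exact.
apply: (is_derive_eq (is_deriveM dn (is_deriveM dq ds))).
rewrite /GRing.scale /= fctE.
have := sqr_sqrtr (ltW h).
move: s0; set s := Num.sqrt _ => s0 es.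
by rewrite -es [x ^+ n.+1]exprS; field; rewrite gt_eqF.
Qed.

Lemma continuous_semicircle_moment (R : realType) (a : R) n :
  continuous (fun x : R => x ^+ n * Num.sqrt (a - x ^+ 2)).
Proof.
by move=> x; apply: cvgM; [exact: exprn_continuous|exact: continuous_semicircle].
Qed.

Lemma continuous_integrable_itv (R : realType) (f : R -> R) (u v : R) :
  continuous f -> lebesgue_measure.-integrable `[u, v] (EFin \o f).
Proof.
move=> cf; apply: continuous_compact_integrable; first exact: segment_compact.
exact: continuous_subspaceT.
Qed.

(** The function x^n (r^2 - x^2)^(3/2) vanishes at both endpoints, so its
    derivative has integral 0.  For n = 0 the right-hand side is 0 and the
    lemma says that the first moment vanishes. *)
Lemma semicircle_moment_rec (R : realType) (r : R) (n : nat) : 0 < r ->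
  n.+3%:R * (\int[lebesgue_measure]_(x in `[- r, r])
                (x ^+ n.+1 * Num.sqrt (r ^+ 2 - x ^+ 2))) =
  r ^+ 2 * n%:R * (\int[lebesgue_measure]_(x in `[- r, r])
                (x ^+ n.-1 * Num.sqrt (r ^+ 2 - x ^+ 2))).
Proof.
move=> r0.
pose w (x : R) := Num.sqrt (r ^+ 2 - x ^+ 2).
pose F (x : R) := x ^+ n * ((r ^+ 2 - x ^+ 2) * w x).
pose f (x : R) := r ^+ 2 * n%:R * (x ^+ n.-1 * w x) - n.+3%:R * (x ^+ n.+1 * w x).
have F0 x : x ^+ 2 = r ^+ 2 -> F x = 0.
  by move=> xr; rewrite /F xr subrr mul0r mulr0.
have cF : continuous F.
  move=> x; apply: cvgM; first exact: exprn_continuous.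
  apply: cvgM; last exact: continuous_semicircle.
  by apply: cvgB; [exact: cvg_cst|exact: exprn_continuous].
have dF x : x \in `]- r, r[ -> is_derive x 1 F (f x).
  rewrite in_itv /= => /andP[lx xr].
  have xr2 : x ^+ 2 < r ^+ 2 by nra.
  apply: (is_derive_eq (is_derive_semicircle R _ x n xr2)).
  (* For n = 0 the exponent n.-1 is 0, but its coefficient vanishes. *)
  rewrite /f -/(w x); case: (n) => [|m] /=; first by ring.
  by rewrite !exprS; ring.
have cg n' : continuous (fun x : R => x ^+ n' * w x).
  exact: continuous_semicircle_moment.
have cZ c n' : continuous (fun x : R => c * (x ^+ n' * w x)).
  by move=> x; apply: cvgM; [exact: cvg_cst|exact: cg].
have cf : continuous f by move=> x; apply: cvgB; exact: cZ.
have rr : - r < r by rewrite gtrN.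
have cf' : {within `[- r, r], continuous f} by exact: continuous_subspaceT.
have oF : derivable_oo_LRcontinuous F (- r) r.
  split; first by move=> x /dF [].
  - by apply: cvg_at_right_filter; exact: cF.
  - by apply: cvg_at_left_filter; exact: cF.
have F' : {in `]- r, r[, derive1 F =1 f}.
  by move=> x xr; rewrite derive1E; have [_ ->] := dF _ xr.
have /(congr1 fine) := continuous_FTC2 rr cf' oF F'.
rewrite !F0 ?sqrrN // -EFinB subrr /=.
have cI c n' := continuous_integrable_itv _ _ (- r) r (cZ c n').
have dI := RintegralB _ (cI (r ^+ 2 * n%:R) n.-1) (cI n.+3%:R n.+1).
move=> /esym ftc; have := etrans ftc (dI (measurable_itv _)).
rewrite !RintegralZl //; [|exact: continuous_integrable_itv..].
by move/esym/eqP; rewrite subr_eq0 => /eqP ->.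
Qed.

Lemma semicircle_density_moment (R : realType) (rho : R) (n : nat) : 0 < rho ->
  let r := 2 / Num.sqrt rho in
  \int[lebesgue_measure]_(x in `[- r, r]) (x ^+ n * semicircle_density rho x) =
  rho / (2 * pi) *
  \int[lebesgue_measure]_(x in `[- r, r]) (x ^+ n * Num.sqrt (r ^+ 2 - x ^+ 2)).
Proof.
move=> rho0 r; have r2 : r ^+ 2 = 4 / rho.
  by rewrite expr_div_n sqr_sqrtr ?ltW //; congr (_ / _); ring.
rewrite -RintegralZl //; last first.
  by apply: continuous_integrable_itv; exact: continuous_semicircle_moment.
by apply: eq_Rintegral => x _; rewrite /semicircle_density r2 mulrCA.
Qed.

Lemma semicircular_schwinger_dyson (R : realType) (N : tracialWstar R)
    (rho : R) (S : N) :
    0 < rho -> semicircular rho S ->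
  forall m, schwinger_dyson rho%:C (fun n => tr N (S ^+ n)) m.
Proof.
move=> rho0 [_ mom].
pose r := 2 / Num.sqrt rho.
have r0 : 0 < r by rewrite divr_gt0 ?sqrtr_gt0.
have r2 : rho * r ^+ 2 = 4.
  by rewrite expr_div_n sqr_sqrtr ?ltW // mulrC divfK ?gt_eqF //; ring.
pose w n := \int[lebesgue_measure]_(x in `[- r, r])
  (x ^+ n * Num.sqrt (r ^+ 2 - x ^+ 2)).
pose c n := rho / (2 * pi) * w n.
have trS n : tr N (S ^+ n) = (c n)%:C.
  by rewrite mom (semicircle_density_moment _ _ _ rho0).
have c0 : c 0%N = 1 by apply: complexI; rewrite -trS expr0 tr1.
have c1 : c 1%N = 0.
  have /eqP := semicircle_moment_rec _ _ 0 r0.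
  by rewrite mulr0 mul0r mulf_eq0 pnatr_eq0 /= => /eqP w1; rewrite /c /w w1 mulr0.
have crec n : rho * n.+4%:R * c n.+2 = 4 * n.+1%:R * c n.
  have /= e := semicircle_moment_rec _ _ n.+1 r0.
  rewrite /c -mulrA [n.+4%:R * _]mulrCA (e : n.+4%:R * w n.+2 = _) -r2 -/(w n).
  by ring.
have sd := schwinger_dyson_catalan rho c (lt0r_neq0 rho0) c0 c1 crec.
move=> m; rewrite /schwinger_dyson trS -rmorphM sd rmorph_sum.
by apply: eq_bigr => i _; rewrite rmorphM !trS.
Qed.

End SemicircleMoments.

(** * Iterated free difference quotients of monomials *)

Section FgliftLinear.
Variables (F : nzRingType) (K : choiceType) (V : lmodType F) (f : K -> V).

HB.instance Definition _ :=
  GRing.isAdditive.Build {freeg K / F} V (fglift f) (lift_is_additive f).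

Lemma fglift_scalable : scalable (fglift f).
Proof.
move=> a D; rewrite -[in RHS](freeg_sumE D) (_ : a *: D = fgscale a D) //.
rewrite !raddf_sum /=.
by apply: eq_bigr => x _; rewrite !liftU scalerA.
Qed.

HB.instance Definition _ :=
  GRing.isScalable.Build F {freeg K / F} V *:%R (fglift f) fglift_scalable.

Lemma fglift_basis x : fglift f << x >> = f x.
Proof. by rewrite liftU scale1r. Qed.

End FgliftLinear.

Section Tensors.
Local Open Scope complex_scope.
Variable R : realType.

Lemma poly_polyTXn m : @poly_polyT R 'X^m = << [tuple m] >>.
Proof.
rewrite /poly_polyT size_polyXn big_ord_recr /= coefXn (eqxx m) scale1r.
rewrite big1 ?add0r //.
by move=> i _; rewrite coefXn ltn_eqF ?scale0r.
Qed.

Lemma poly_polyTZXn a m :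
  @poly_polyT R (a *: 'X^m) = a *: << [tuple m] >>.
Proof.
have [->|a0] := eqVneq a 0.
  by rewrite !scale0r /poly_polyT size_poly0 big_ord0.
rewrite -poly_polyTXn /poly_polyT size_scale // scaler_sumr.
by apply: eq_bigr => i _; rewrite coefZ scalerA.
Qed.

HB.instance Definition _ n :=
  GRing.Linear.copy (@fdq_first R n) (fglift _ : polyT R n.+1 -> polyT R n.+2).

Lemma fdq_first_basis n (m : n.+1.-tuple nat) :
  fdq_first (<< m >> : polyT R n.+1) =
  \sum_(1 <= j < (thead m).+1)
      << [tuple of j.-1 :: (thead m - j)%N :: behead_tuple m] >>.
Proof. exact: fglift_basis. Qed.

(** The filtration by the first exponent: the free difference quotient of the
    first factor lowers it strictly and so maps level d + 1 to level d.  The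
    coefficients that occur are natural numbers, hence the list, in which a
    tuple may be repeated. *)
Definition low_head n d (T : polyT R n.+1) :=
  exists s : seq (n.+1.-tuple nat),
    all (fun m => thead m < d)%N s /\ T = \sum_(m <- s) << m >>.

Lemma low_head0 n (T : polyT R n.+1) : low_head n 0 T -> T = 0.
Proof. by case=> [[|m s] [// _ ->]]; rewrite big_nil. Qed.

Lemma low_headD n d T U : low_head n d T -> low_head n d U -> low_head n d (T + U).
Proof.
by move=> [s [sd ->]] [t [td ->]]; exists (s ++ t); rewrite all_cat sd td big_cat.
Qed.

Lemma low_head_sum n d I (r : seq I) (P : pred I) E :
  (forall i, P i -> low_head n d (E i)) -> low_head n d (\sum_(i <- r | P i) E i).
Proof.
move=> h; elim/big_ind: _ => //; first by exists [::]; rewrite big_nil.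
exact: low_headD.
Qed.

Lemma low_head_basis n d (m : n.+1.-tuple nat) :
  (thead m < d)%N -> low_head n d << m >>.
Proof. by move=> h; exists [:: m]; rewrite /= h big_seq1. Qed.

Lemma low_head_fdq n d (T : polyT R n.+1) :
  low_head n d.+1 T -> low_head n.+1 d (fdq_first T).
Proof.
move=> [s [/allP sd ->]]; rewrite linear_sum big_seq.
apply: low_head_sum => m /sd hm.
rewrite /= fdq_first_basis big_nat; apply: low_head_sum => -[|j] // /andP[_ jm].
by apply: low_head_basis; exact: leq_trans jm hm.
Qed.

(** Among the terms of d t^(d+1) = sum t^(j-1) (x) t^(d+1-j), only j = d + 1
    reaches the first exponent d, and it has second exponent 0.  The later
    quotients act on the first factor only and leave this zero in place, so the
    leading term keeps the coefficient 1 and gains one zero at each step. *)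
Lemma fdq_leading k d :
  low_head k d (fdq k ('X^(k + d) : {poly R[i]}) - << [tuple of d :: nseq k 0%N] >>).
Proof.
elim: k d => [|k IH] d.
  rewrite /= poly_polyTXn add0n.
  rewrite (_ : [tuple of _] = [tuple d]); last exact: val_inj.
  by rewrite subrr; exists [::]; rewrite big_nil.
have /low_head_fdq := IH d.+1; rewrite -addSnnS linearB /= fdq_first_basis.
rewrite big_nat_recr //= opprD addrCA addrC.
set L := \sum_(_ <= _ < _) _; set u := << [tuple of d :: _] >>.
have -> : u = << [tuple of d :: nseq k.+1 0%N] >>.
  by congr << _ >>; apply: val_inj; rewrite /= subnn.
move=> /low_headD h; rewrite -[_ - _](subrK L); apply: h.
rewrite /L big_nat; apply: low_head_sum => -[|j] // /andP[_ jd].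
exact: low_head_basis.
Qed.

Lemma fdq_monomial_top k :
  fdq k ('X^k : {poly R[i]}) = << [tuple of 0%N :: nseq k 0%N] >>.
Proof.
by have /low_head0/eqP := fdq_leading k 0; rewrite addn0 subr_eq0 => /eqP.
Qed.

(** The m-th quotient of t^m is 1 (x) ... (x) 1, which the next one kills. *)
Lemma fdq_monomial_lt k m : (m < k)%N -> fdq k ('X^m : {poly R[i]}) = 0.
Proof.
elim: k => // k IH; rewrite ltnS leq_eqVlt => /predU1P[->|/IH h] /=.
  by rewrite fdq_monomial_top fdq_first_basis /= big_geq.
by rewrite h linear0.
Qed.

Lemma fdq1_scaled_monomial (a : R[i]) m :
  fdq 1 (a *: 'X^m : {poly R[i]}) =
  a *: \sum_(1 <= j < m.+1) << [tuple j.-1; (m - j)%N] >>.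
Proof.
rewrite /= poly_polyTZXn linearZ /= fdq_first_basis; congr (_ *: _).
apply: eq_bigr => j _; congr << _ >>; exact: val_inj.
Qed.

Lemma cyclic_derivative_potential (rho : R) :
  cyclic_derivative (potential rho) = rho%:C *: 'X.
Proof.
rewrite /cyclic_derivative fdq1_scaled_monomial linearZ /= linear_sum /=.
rewrite big_nat_recl // big_nat1 !fglift_basis.
rewrite !(tnth_nth 0%N) /= expr0 mulr1 mul1r.
by rewrite scalerDr -scalerDl -rmorphD -splitr.
Qed.
End Tensors.

(** * The Stein equation on monomials *)

Section Traces.
Local Open Scope complex_scope.
Variables (R : realType) (M : tracialWstar R).

Lemma star1 : star (1 : M) = 1.
Proof. by have := starM (star 1) (1 : M); rewrite mulr1 starK mulr1 => <-. Qed.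

Lemma star_exp (X : M) n : selfadjoint X -> star (X ^+ n) = X ^+ n.
Proof.
move=> sX; elim: n => [|n IH]; first by rewrite !expr0 star1.
by rewrite exprSr starM IH sX -exprS exprSr.
Qed.

Variables (H : forall n : nat, L2tensor M n).

HB.instance Definition _ n (X : M) :=
  GRing.Linear.copy (@evalT R M n (H n) X) (fglift _ : polyT R n -> H n).

Lemma evalT_basis n (X : M) (m : n.-tuple nat) :
  evalT (H n) X << m >> = elem (H n) (fun i => X ^+ tnth m i).
Proof. exact: fglift_basis. Qed.

Lemma L2star_sum n I (r : seq I) (E : I -> H n) :
  L2star (\sum_(i <- r) E i) = \sum_(i <- r) L2star (E i).
Proof.
have L2starD u v : L2star (u + v : H n) = L2star u + L2star v.
  by rewrite -[u]scale1r L2star_antilinear rmorph1 !scale1r.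
apply: (big_morph (@L2star R M n (H n)) L2starD); apply: (addrI (L2star (0 : H n))).
by rewrite -L2starD !addr0.
Qed.

Lemma L2dot_suml n I (r : seq I) (E : I -> H n) (v : H n) :
  L2dot (H n) (\sum_(i <- r) E i) v = \sum_(i <- r) L2dot (H n) (E i) v.
Proof. exact: linear_sumlz. Qed.

Lemma L2tr_star_evalT_fdq1 (X : M) m : selfadjoint X ->
  L2tr (L2star (evalT (H 2) X (fdq 1 ('X^m : {poly R[i]})))) =
  \sum_(i < m) tr M (X ^+ i) * tr M (X ^+ (m - i.+1)).
Proof.
move=> sX; rewrite -['X^m]scale1r fdq1_scaled_monomial scale1r linear_sum /=.
rewrite L2star_sum /L2tr L2dot_suml big_add1 big_mkord; apply: eq_bigr => i _.
rewrite evalT_basis L2star_elem elem_dot big_ord_recl big_ord1 !(tnth_nth 0%N) /=.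
by rewrite star1 !mulr1 !star_exp.
Qed.

Lemma tau_dot_potential (rho : R) (X : M) m : selfadjoint X ->
  tau_dot (horner_alg X (cyclic_derivative (potential rho))) (horner_alg X ('X^m))
   = rho%:C * tr M (X ^+ m.+1).
Proof.
move=> sX; rewrite /tau_dot cyclic_derivative_potential.
rewrite linearZ /= rmorphXn /= !horner_algX star_exp // mulr_algl -scalerAr.
by rewrite linearZ /= -exprSr.
Qed.

Lemma stein_kernel_monomial (rho : R) (X : M) (k m : nat) (A : H k.+1) :
    selfadjoint X -> free_stein_kernel rho X A ->
  rho%:C * tr M (X ^+ m.+1) - autoconv (fun n => tr M (X ^+ n)) m =
  L2dot (H k.+1) A (evalT (H k.+1) X (fdq k 'X^m)).
Proof.
by move=> sX /(_ 'X^m); rewrite tau_dot_potential // L2tr_star_evalT_fdq1.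
Qed.

Lemma stein_kernel_schwinger_dyson (rho : R) (X : M) (k m : nat) (A : H k.+1) :
    selfadjoint X -> free_stein_kernel rho X A -> (m < k)%N ->
  schwinger_dyson rho%:C (fun n => tr M (X ^+ n)) m.
Proof.
move=> sX /(stein_kernel_monomial _ _ _ m _ sX) + mk.
rewrite fdq_monomial_lt // [evalT _ _ _]linear0 (linear0r (L2dot (H k.+1))) => /eqP.
by rewrite subr_eq0 => /eqP.
Qed.

Lemma stein_kernel_mean (rho : R) (X : M) (k : nat) (A : H k.+1) :
    selfadjoint X -> free_stein_kernel rho X A ->
  L2tr A = rho%:C * tr M (X ^+ k.+1) - autoconv (fun n => tr M (X ^+ n)) k.
Proof.
move=> sX /(stein_kernel_monomial _ _ _ k _ sX) ->.
rewrite fdq_monomial_top evalT_basis; congr (L2dot _ _ (elem _ _)).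
apply/funext => i; rewrite (tnth_nth 0%N) /=; case: (val i) => // j.
by rewrite /= nth_nseq if_same expr0.
Qed.
End Traces.

(** * Determination of the moments *)

Lemma tr_horner_alg (R : realType) (M : tracialWstar R) (X : M) (P : {poly R[i]%C}) :
  tr M (horner_alg X P) = \sum_(i < size P) P`_i * tr M (X ^+ i).
Proof.
rewrite -{1}[P]coefK poly_def !linear_sum /=; apply: eq_bigr => i _.
rewrite -mul_polyC rmorphM /= horner_algC rmorphXn /= horner_algX.
by rewrite mulr_algl linearZ.
Qed.

Theorem lemma1 (R : realType) (M : tracialWstar R)
    (H : forall n : nat, L2tensor M n) (rho : R) (k : nat) (X : M)
    (A : forall i : nat, H i.+1)
    (N : tracialWstar R) (Srho : N) :
  0 < rho -> (1 <= k)%N -> selfadjoint X -> semicircular rho Srho ->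
  (forall i : nat, (1 <= i <= k)%N -> free_stein_kernel rho X (A i)) ->
  (forall P : {poly R[i]}, (size P <= k.+1)%N ->
     tr M (horner_alg X P) = tr N (horner_alg Srho P)) /\
  ((forall P : {poly R[i]}, size P = k.+2 ->
      tr M (horner_alg X P) = tr N (horner_alg Srho P)) ->
   forall i : nat, (1 <= i <= k)%N -> L2tr (A i) = 0).
Proof.
move=> rho0 k1 sX semi kern.
have rhoC : (rho%:C)%C != 0 by rewrite fmorph_eq0 gt_eqF.
pose mX n := tr M (X ^+ n); pose mS n := tr N (Srho ^+ n).
have sdS : forall m, schwinger_dyson (rho%:C)%C mS m.
  exact: semicircular_schwinger_dyson rho0 semi.
(* The kernel of order k alone gives all the equations of degree less than k. *)
have mXS n : (n <= k)%N -> mX n = mS n.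
  move: n; apply: (schwinger_dyson_unique _ _ _ _ rhoC) => // [|m mk].
    by rewrite /mX /mS !expr0 !tr1.
  by apply: stein_kernel_schwinger_dyson sX _ mk; apply: kern; rewrite k1 leqnn.
split=> [P sP|top i /andP[i1 ik]].
  rewrite !tr_horner_alg; apply: eq_bigr => i _; congr (_ * _); apply: mXS.
  by rewrite -ltnS; exact: leq_trans (ltn_ord i) sP.
have mXS1 n : (n <= k.+1)%N -> mX n = mS n.
  rewrite leq_eqVlt => /predU1P[->|/mXS //].
  have := top 'X^(k.+1); rewrite size_polyXn => /(_ erefl).
  by rewrite !rmorphXn /= !horner_algX.
rewrite (stein_kernel_mean _ _ _ _ _ _ _ sX (kern i _)) ?i1 //.
apply/eqP; rewrite subr_eq0; apply/eqP.
apply: (schwinger_dyson_local _ _ mS) => // j ji.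
by apply: mXS1; exact: leq_trans ji _.
Qed.
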